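(* Let $\mathcal{D}$ be a quantitative transaction database over a finite item set $I$ with external utilities $eu$, a given membership function, a total processing order on $I$, and a minimum fuzzy utility threshold $\gamma$. Let $X$ and $Y$ be two fuzzy itemsets such that $Y$ is processed after $X$, meaning that $XY:=X\cup Y$ is an extension of $X$. If $$\sum_{T_j\in ful(X)}\bigl(ifu(X,T_j)+rfu(X,T_j)\bigr)-\sum_{T_j\in ful(X),\ Y\not\subseteq T_j}\bigl(ifu(X,T_j)+rfu(X,T_j)\bigr)<\gamma ,$$ then no extension of $XY$ is a high fuzzy utility itemset, i.e. $fu_Z<\gamma$ for every extension $Z$ of $XY$.
   Context: Database. $I=\{x_1,\dots,x_m\}$ is a finite set of items; each item $x_i$ has a positive external (unit) utility $eu(x_i)$. A quantitative database $\mathcal{D}=\{T_1,\dots,T_n\}$ is a finite collection of transactions; each $T_j$ assigns to every item $x_i$ a quantity $q(x_i,T_j)\ge 0$, and $x_i\in T_j$ means $q(x_i,T_j)>0$. Membership. Each item $x_i$ has finitely many fuzzy regions $R_{i1},R_{i2},\dots$ (e.g. Low, Middle, High). The membership function converts the quantity $q(x_i,T_j)$ into membership values $f_{ijl}\in[0,1]$, one for each region $R_{il}$. A fuzzy item is a pair (item $x_i$, region $R_{il}$). A fuzzy itemset $X$ is a nonempty finite set of fuzzy items with at most one region chosen for each item. $X\subseteq T_j$ means that all underlying items of $X$ belong to $T_j$. Fuzzy utility. For $x_i\in T_j$, the fuzzy utility of the $l$-th region is $fu_{ijl}=f_{ijl}\cdot q(x_i,T_j)\cdot eu(x_i)$,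 and the maximum fuzzy utility of $x_i$ in $T_j$ is $mfu_{ij}=\max_l fu_{ijl}$. For a fuzzy itemset $X\subseteq T_j$, $fu_{jX}=f_{jX}\cdot\sum_{x_i}q(x_i,T_j)\,eu(x_i)$, where the sum is over the underlying items of $X$ and $f_{jX}$ is the minimum of the membership values in $T_j$ of the fuzzy items of $X$. The total fuzzy utility is $fu_X=\sum_{T_j\in\mathcal{D},\,X\subseteq T_j}fu_{jX}$. $X$ is a high fuzzy utility itemset (HFUI) if $fu_X\ge\gamma$. Order and extensions. A total order on $I$ is fixed (the processing order). $T_j/X$ denotes the set of items of $T_j$ that come after all underlying items of $X$ in this order. An extension of $X$ is a fuzzy itemset $X'\supsetneq X$ such that the underlying items of all fuzzy items in $X'\setminus X$ come after all underlying items of $X$. Fuzzy-list. $ful(X)$ denotes the set of transactions $T_j\in\mathcal{D}$ with $X\subseteq T_j$. For $T_j\in ful(X)$ put $ifu(X,T_j)=fu_{jX}$ and $rfu(X,T_j)=\sum_{x_i\in T_j/X}mfu_{ij}$. *)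

(* Defs.v *)
From HB Require Import structures.
From mathcomp Require Import all_boot all_order all_algebra.
Set Implicit Arguments.
Unset Strict Implicit.
Unset Printing Implicit Defensive.
Import Order.TTheory GRing.Theory Num.Theory.
Local Open Scope ring_scope.

(* The processing order is the canonical order of the item type [I].
   Transactions are named by an index, so that two of them may carry the same
   quantities. *)
Record fuzzy_db (R : realFieldType) (disp : Order.disp_t)
    (I : finOrderType disp) := FuzzyDb {
  ntrans : nat;
  eu : I -> R;
  eu_gt0 : forall i, 0 < eu i;
  qty : I -> 'I_ntrans -> R;
  qty_ge0 : forall i j, 0 <= qty i j;
  region : I -> finType;
  membership : forall i, region i -> R -> R;
  membership_itv : forall i (l : region i) (x : R),
    0 <= x -> 0 <= membership l x <= 1
}.

Section FuzzyUtility.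
Context {R : realFieldType} {disp : Order.disp_t} {I : finOrderType disp}.
Variable D : fuzzy_db R I.
Implicit Types (i : I) (j : 'I_(ntrans D)).

Definition titems j : {set I} := [set i | 0 < qty i j].

Definition fuzzy_item := {i : I & region D i}.

Implicit Types (X Y : {set fuzzy_item}).

Definition items X : {set I} := [set tag a | a in X].

Definition fuzzy_itemset X : Prop :=
  X != set0 /\ {in X &, forall a b : fuzzy_item, tag a = tag b -> a = b}.

Definition occurs X j : bool := items X \subset titems j.

Definition fval i j (l : region D i) : R := membership l (qty i j).

Definition fu_region i j (l : region D i) : R := fval j l * qty i j * eu D i.

(* The default 0 is harmless: all the [fu_region] are nonnegative. *)
Definition mfu i j : R := \big[Order.max/0]_(l : region D i) fu_region j l.

(* The default 1 is harmless: an itemset is nonempty and all the membership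
   values are at most 1. *)
Definition fval_set X j : R :=
  \big[Order.min/1]_(a in X) fval j (tagged a).

Definition fu_trans X j : R :=
  fval_set X j * (\sum_(i in items X) qty i j * eu D i).

Definition fu X : R := \sum_(j | occurs X j) fu_trans X j.

Definition HFUI (gamma : R) X : bool := gamma <= fu X.

Definition remaining X j : {set I} :=
  [set i in titems j | [forall k in items X, (k < i)%O]].

Definition extension X X' : Prop :=
  [/\ fuzzy_itemset X', X \proper X'
    & forall i k, i \in items (X' :\: X) -> k \in items X -> (k < i)%O].

Definition ful X : {set 'I_(ntrans D)} := [set j | occurs X j].

Definition ifu X j : R := fu_trans X j.

Definition rfu X j : R := \sum_(i in remaining X j) mfu i j.

End FuzzyUtility.

(* Main.v *)
(** Relative to the prefix [X], the utility of an extension [Z] in one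
    transaction is at most [ifu + rfu]: the membership degree of [Z] is at most
    that of [X], which bounds the share of the items of [X], and at most that of
    each added fuzzy item, which bounds the share of an added item by its [mfu].
    Only transactions containing both [X] and [Y] can support an extension of
    [X :|: Y], and the difference in the hypothesis sums exactly over these. *)
Require Import Defs.
From HB Require Import structures.
From mathcomp Require Import all_boot all_order all_algebra.
Set Implicit Arguments.
Unset Strict Implicit.
Unset Printing Implicit Defensive.
Import Order.TTheory GRing.Theory Num.Theory.
Local Open Scope ring_scope.

Section FuzzyUtilityTheory.
Context {R : realFieldType} {disp : Order.disp_t} {I : finOrderType disp}.
Variable D : fuzzy_db R I.
Implicit Types (i : I) (j : 'I_(ntrans D)) (X Y Z : {set fuzzy_item D}).

Lemma itemsS X Y : X \subset Y -> items X \subset items Y.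
Proof. exact: imsetS. Qed.

Lemma itemsU X Y : items (X :|: Y) = items X :|: items Y.
Proof. exact: imsetU. Qed.

Lemma occursU X Y j : occurs (X :|: Y) j = occurs X j && occurs Y j.
Proof. by rewrite /occurs itemsU subUset. Qed.

Lemma occursS X Y j : X \subset Y -> occurs Y j -> occurs X j.
Proof. by move=> /itemsS; apply: subset_trans. Qed.

Lemma fval_ge0 i j (l : region D i) : 0 <= fval j l.
Proof. by case/andP: (membership_itv l (qty_ge0 i j)). Qed.

Lemma utility_ge0 i j : 0 <= qty i j * eu D i.
Proof. by rewrite mulr_ge0 ?qty_ge0 // ltW ?eu_gt0. Qed.

Lemma mfu_ge0 i j : 0 <= mfu i j.
Proof. exact: bigmax_ge_id. Qed.

Lemma fval_set_ge0 X j : 0 <= fval_set X j.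
Proof. by apply: le_bigmin => // a _; apply: fval_ge0. Qed.

Lemma fval_setS X Y j : X \subset Y -> fval_set Y j <= fval_set X j.
Proof.
move=> /subsetP sXY; apply: le_bigmin => [|a /sXY Ya].
  exact: bigmin_le_id.
exact: bigmin_le_cond.
Qed.

Lemma fu_trans_ge0 X j : 0 <= fu_trans X j.
Proof.
by rewrite mulr_ge0 ?fval_set_ge0 ?sumr_ge0 // => i _; apply: utility_ge0.
Qed.

Lemma rfu_ge0 X j : 0 <= rfu X j.
Proof. by apply: sumr_ge0 => i _; apply: mfu_ge0. Qed.

(** The minimum [fval_set X j] is at most the degree of [a], and the product with that degree is one
    of the terms of the maximum [mfu]. *)
Lemma fval_set_mfu X j (a : fuzzy_item D) : a \in X ->
  fval_set X j * (qty (tag a) j * eu D (tag a)) <= mfu (tag a) j.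
Proof.
move=> Xa; apply: (@le_trans _ _ (fu_region j (tagged a))).
  rewrite /fu_region -mulrA ler_wpM2r ?utility_ge0 //.
  exact: bigmin_le_cond.
exact: le_bigmax.
Qed.

(** A fuzzy item of [Z] outside [X] either enters with [Y], or comes after all items of [Y], hence
    after those of [X]. *)
Lemma extension_trans X Y Z : extension X Y -> extension Y Z -> extension X Z.
Proof.
move=> [_ ltXY ordXY] [fZ ltYZ ordYZ].
split=> [//||i k]; first exact: proper_trans ltXY ltYZ.
case/imsetP=> a; rewrite inE => /andP[XNa Za] -> Xk.
have [Ya|YNa] := boolP (a \in Y).
  by apply: ordXY => //; apply: imset_f; rewrite inE XNa.
apply: ordYZ; first by apply: imset_f; rewrite inE YNa.
exact: subsetP (itemsS (proper_sub ltXY)) _ Xk.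
Qed.

Lemma fu_trans_extension X Z j :
  extension X Z -> occurs Z j -> fu_trans Z j <= ifu X j + rfu X j.
Proof.
move=> [_ /proper_sub sXZ ordXZ] ocZ.
have itemsZ : items Z = items X :|: items (Z :\: X).
  by rewrite -itemsU -{1}(setIidPr sXZ) setID.
(* A common item would strictly precede itself. Disjointness lets the utility sum over [items Z] be
   split in two. *)
have disj : [disjoint items X & items (Z :\: X)].
  rewrite disjoint_subset; apply/subsetP=> i Xi; rewrite inE.
  by apply/negP=> /ordXZ/(_ Xi); rewrite ltxx.
have subrem : items (Z :\: X) \subset remaining X j.
  apply/subsetP=> i Zi; rewrite inE; apply/andP; split.
    by apply: (subsetP ocZ); apply: subsetP (itemsS (subsetDl Z X)) _ Zi.
  by apply/forall_inP=> k; apply: ordXZ.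
rewrite /fu_trans itemsZ (eq_bigl _ _ (fun i => in_setU i _ _)) bigU //= mulrDr lerD //.
  rewrite ler_wpM2r ?fval_setS // sumr_ge0 // => i _; exact: utility_ge0.
(* Remaining items not added by [Z] contribute only nonnegative [mfu] terms to the right-hand
   side. *)
rewrite mulr_sumr /rfu [leRHS](big_setID (items (Z :\: X))) /= (setIidPr subrem).
rewrite -[leLHS]addr0 lerD ?sumr_ge0 // => [|i _]; last exact: mfu_ge0.
apply: ler_sum => _ /imsetP[a /setDP[Za _] ->]; exact: fval_set_mfu.
Qed.

End FuzzyUtilityTheory.

Theorem theorem5 (R : realFieldType) (disp : Order.disp_t)
    (I : finOrderType disp) (D : fuzzy_db R I) (gamma : R)
    (X Y : {set fuzzy_item D})
    (hX : fuzzy_itemset X) (hY : fuzzy_itemset Y)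
    (hXY : extension X (X :|: Y))
    (hlt : \sum_(j in ful X) (ifu X j + rfu X j)
           - \sum_(j in ful X | ~~ occurs Y j) (ifu X j + rfu X j) < gamma) :
  forall Z : {set fuzzy_item D},
    extension (X :|: Y) Z -> ~~ HFUI gamma Z.
Proof.
move=> Z extZ; rewrite /HFUI -ltNge; apply: le_lt_trans hlt.
(* Splitting the first sum by [occurs Y] cancels the subtracted one. *)
rewrite (bigID (occurs Y)) /= addrK /fu.
have [_ /proper_sub sXYZ _] := extZ.
have bound j : occurs Z j -> fu_trans Z j <= ifu X j + rfu X j.
  exact: fu_trans_extension (extension_trans hXY extZ).
apply: le_trans (ler_sum _ bound) _.
(* Transactions containing [X] and [Y] but not [Z] contribute nonnegative terms; the others are
   exactly those containing [Z]. *)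
rewrite [leRHS](bigID (fun j => occurs Z j)) /= -[leLHS]addr0 lerD //.
  rewrite le_eqVlt; apply/orP; left; apply/eqP/eq_bigl => j; rewrite inE.
  by rewrite -occursU andb_idl //; apply: occursS.
by apply: sumr_ge0 => j _; rewrite addr_ge0 ?fu_trans_ge0 ?rfu_ge0.
Qed.
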